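(* Let $\mathcal{X}$ be an infinite-dimensional type $1$ normed space over $\mathbb{F}$ and let $T\in\mathcal{B}[\mathcal{X}]$ be a power bounded operator that is weakly l-sequentially supercyclic. Then either (i) $T$ is weakly stable, or (ii) if $y\in\mathcal{X}$ is a weakly l-sequentially supercyclic vector for $T$ such that $\{T^ny\}_{n\ge0}$ does not converge weakly to $0$, then for every nonzero $f\in\mathcal{X}^*$ such that $f(T^ny)\not\to0$ either $$\liminf_n|f(T^ny)|=0,$$ or $$\limsup_k|f(T^{n_k}y)|<\|f\|\,\limsup_k\|T^{n_k}y\|$$ for some subsequence $\{T^{n_k}\}_{k\ge0}$ of $\{T^n\}_{n\ge0}$.
   Context: $\mathbb{F}$ is either $\mathbb{R}$ or $\mathbb{C}$. $\mathcal{B}[\mathcal{X}]$ is the normed algebra of all operators (bounded linear maps) of $\mathcal{X}$ into itself, and $\mathcal{X}^*$ is the dual of $\mathcal{X}$. $T$ is power bounded if $\sup_{n\ge0}\|T^n\|<\infty$. $T$ is weakly stable if $T^nx$ converges weakly to $0$ for every $x\in\mathcal{X}$. A normed space $\mathcal{X}$ is of type $1$ (a Radon–Riesz space) if, for every $\mathcal{X}$-valued sequence $\{x_k\}_{k\ge0}$ and every $x\in\mathcal{X}$, $x_k\to x$ in norm if and only if $x_k\to x$ weakly and $\|x_k\|\to\|x\|$. A nonzero vector $y\in\mathcal{X}$ is a weakly l-sequentially supercyclic vector for $T$ if for every $x\in\mathcal{X}$ there exist a sequence $\{\alpha_k\}_{k\ge0}$ of nonzero numbers in $\mathbb{F}$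 and a subsequence $\{T^{n_k}\}_{k\ge0}$ of $\{T^n\}_{n\ge0}$ (both depending on $x$ and $y$) such that $\alpha_kT^{n_k}y$ converges weakly to $x$. $T$ is weakly l-sequentially supercyclic if it has a weakly l-sequentially supercyclic vector. *)

(* Defs.v *)
From Stdlib Require Import Reals.
From Coquelicot Require Import Coquelicot.
Open Scope R_scope.

(* Bounded linear maps are Coquelicot's [is_linear], whose field [linear_norm]
   is boundedness. The scalar field, as a normed space over itself, is
   [AbsRing_NormedModule F]. Scalars range over an arbitrary [AbsRing] here;
   only [R_AbsRing] and [C_AbsRing] are intended. *)

(* [sum_n u n] has the [n + 1] terms [u 0, ..., u n], so this denies that some
   finite family spans [X]; the zero space is excluded by [n = 0], [e 0 = zero]. *)
Definition infinite_dimensional {F : AbsRing} (X : NormedModule F) : Prop :=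
  ~ exists (n : nat) (e : nat -> X),
      forall x : X, exists c : nat -> F, x = sum_n (fun i => scal (c i) (e i)) n.

Definition dual_elt {F : AbsRing} {X : NormedModule F}
    (f : X -> AbsRing_NormedModule F) : Prop := is_linear f.

Definition norm_conv {F : AbsRing} {X : NormedModule F}
    (u : nat -> X) (x : X) : Prop :=
  filterlim u eventually (locally x).

Definition weak_conv {F : AbsRing} {X : NormedModule F}
    (u : nat -> X) (x : X) : Prop :=
  forall f : X -> AbsRing_NormedModule F, dual_elt f ->
    norm_conv (fun k => f (u k)) (f x).

Definition type1 {F : AbsRing} (X : NormedModule F) : Prop :=
  forall (u : nat -> X) (x : X),
    norm_conv u x <->
    (weak_conv u x /\ is_lim_seq (fun k => norm (u k)) (norm x)).

(* The supremum is taken in [Rbar]; it is finite for bounded linear maps. *)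
Definition op_norm {F : AbsRing} {X Y : NormedModule F} (l : X -> Y) : Rbar :=
  Lub_Rbar (fun r => exists x : X, norm x <= 1 /\ r = norm (l x)).

Definition op_pow {F : AbsRing} {X : NormedModule F} (T : X -> X) (n : nat) :
    X -> X :=
  Nat.iter n T.

Definition power_bounded {F : AbsRing} {X : NormedModule F} (T : X -> X) : Prop :=
  Rbar_lt (Sup_seq (fun n => op_norm (op_pow T n))) p_infty.

Definition weakly_stable {F : AbsRing} {X : NormedModule F} (T : X -> X) : Prop :=
  forall x : X, weak_conv (fun n => op_pow T n x) zero.

Definition subseq_index (phi : nat -> nat) : Prop :=
  forall k : nat, (phi k < phi (S k))%nat.

Definition wl_supercyclic_vector {F : AbsRing} {X : NormedModule F}
    (T : X -> X) (y : X) : Prop :=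
  y <> zero /\
  forall x : X, exists (alpha : nat -> F) (phi : nat -> nat),
    (forall k, alpha k <> zero) /\ subseq_index phi /\
    weak_conv (fun k => scal (alpha k) (op_pow T (phi k) y)) x.

Definition wl_supercyclic {F : AbsRing} {X : NormedModule F} (T : X -> X) : Prop :=
  exists y : X, wl_supercyclic_vector T y.

(* Main.v *)
Require Import Defs.
From Stdlib Require Import Reals.
From Coquelicot Require Import Coquelicot.
From Stdlib Require Import Lra Lia Classical.
Open Scope R_scope.

(** The first alternative of the inner disjunction holds for every nonzero
    bounded functional [f]: the values [f (T^n y)] always come arbitrarily
    close to zero.

    Suppose that [|f (T^n y)| >= c > 0] for all large [n], and let [x] be in
    the kernel of [f].  Supercyclicity provides scalars [a_k] and indices
    [n_k] with [a_k T^(n_k) y -> x] weakly.  Applying [f] gives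
    [a_k f (T^(n_k) y) -> 0], so the lower bound [c] forces [a_k -> 0]; the
    orbit being bounded, [a_k T^(n_k) y -> 0] in norm, hence weakly.  Weak
    limits are unique ([weak_conv_unique]), so [x = 0].  The nonzero
    functional [f] is then injective, which confines [X] to a line
    ([finite_dimensional_of_injective_functional]) and contradicts infinite
    dimension.

    Uniqueness of weak limits usually rests on the Hahn-Banach theorem.  In a
    type 1 space it is immediate: a vector [z] annihilated by every bounded
    functional is a weak limit, with matching norm, of the constant sequence
    [-z], and the Radon-Riesz property makes it a norm limit as well, so
    [z = -z]. *)

(** * Scalars *)

(** What the argument needs from the scalars, so that the real and complex
    cases are treated at once: a field of characteristic other than 2 with a
    multiplicative absolute value that attains every positive real. *)
Definition fully_valued_field (F : AbsRing) : Prop :=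
  (forall a b : F, abs (mult a b) = abs a * abs b) /\
  (forall a : F, a <> zero -> exists b : F, mult b a = one) /\
  (forall r : R, 0 < r -> exists a : F, abs a = r) /\
  plus one one <> (zero : F).

Lemma fully_valued_R : fully_valued_field R_AbsRing.
Proof.
split; [exact Rabs_mult | split; [| split]].
- intros a ha. exists (/ a). exact (Rinv_l a ha).
- intros r hr. exists r. exact (Rabs_pos_eq r (Rlt_le _ _ hr)).
- change (1 + 1 <> 0). lra.
Qed.

Lemma fully_valued_C : fully_valued_field C_AbsRing.
Proof.
split; [exact Cmod_mult | split; [| split]].
- intros a ha. exists (Cinv a). exact (Cinv_l a ha).
- intros r hr. exists (RtoC r).
  change (Cmod (RtoC r) = r). rewrite Cmod_R. now apply Rabs_pos_eq, Rlt_le.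
- intros h. apply (f_equal fst) in h. change (1 + 1 = 0) in h. lra.
Qed.

Lemma eq_of_plus_opp_eq_zero (G : AbelianGroup) (x y : G) :
  plus x (opp y) = zero -> x = y.
Proof.
intros h. apply (plus_reg_r (opp y)). now rewrite plus_opp_r.
Qed.

(** * Convergence *)

Lemma norm_conv_zero_iff (F : AbsRing) (X : NormedModule F) (u : nat -> X) :
  norm_conv u zero <->
  forall eps : R, 0 < eps ->
    exists N : nat, forall n, (N <= n)%nat -> norm (u n) < eps.
Proof.
unfold norm_conv. rewrite filterlim_locally_ball_norm. unfold ball_norm.
assert (hminus : forall n, minus (u n) zero = u n)
  by (intros n; apply minus_zero_r).
split.
- intros h eps heps. destruct (h (mkposreal eps heps)) as [N hN].
  exists N. intros n hn. specialize (hN n hn). simpl in hN.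
  now rewrite hminus in hN.
- intros h eps. destruct (h eps (cond_pos eps)) as [N hN].
  exists N. intros n hn. rewrite hminus. exact (hN n hn).
Qed.

Lemma norm_conv_const (F : AbsRing) (X : NormedModule F) (x : X) :
  norm_conv (fun _ => x) x.
Proof. apply filterlim_const. Qed.

Lemma norm_conv_unique (F : AbsRing) (X : NormedModule F)
    (u : nat -> X) (x x' : X) :
  norm_conv u x -> norm_conv u x' -> x = x'.
Proof. apply filterlim_locally_unique. Qed.

(** The type 1 property replaces the Hahn-Banach theorem here: if every
    functional annihilates [z], the constant sequence [-z] converges weakly
    to [z] and has the right norm, so it converges to [z] in norm. *)
Lemma dual_separates_points (F : AbsRing) (hF : fully_valued_field F)
    (X : NormedModule F) (htype : type1 X) (z : X) :
  (forall g : X -> AbsRing_NormedModule F, dual_elt g -> g z = zero) ->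
  z = zero.
Proof.
intros hz.
assert (hopp : opp z = z).
{ apply (norm_conv_unique F X (fun _ => opp z)).
  - apply norm_conv_const.
  - apply htype. split.
    + intros g hg. rewrite (linear_opp g z hg), (hz g hg).
      rewrite (opp_zero : opp (zero : AbsRing_NormedModule F) = zero).
      apply norm_conv_const.
    + rewrite norm_opp. apply is_lim_seq_const. }
assert (hzz : plus z z = zero).
{ rewrite <- hopp at 1. exact (plus_opp_l z). }
destruct hF as (_ & hinv & _ & hchar). destruct (hinv _ hchar) as [b hb].
rewrite <- (scal_one z), <- hb, <- scal_assoc.
rewrite (scal_distr_r one one z), !scal_one.
transitivity (scal b (zero : X)); [| exact (scal_zero_r b)].
f_equal. exact hzz.
Qed.

Lemma weak_conv_unique (F : AbsRing) (hF : fully_valued_field F)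
    (X : NormedModule F) (htype : type1 X) (u : nat -> X) (x x' : X) :
  weak_conv u x -> weak_conv u x' -> x = x'.
Proof.
intros hx hx'.
assert (hz : plus x (opp x') = zero).
{ apply (dual_separates_points F hF X htype). intros g hg.
  rewrite (linear_plus g hg), (linear_opp g x' hg).
  rewrite (norm_conv_unique _ _ _ _ _ (hx g hg) (hx' g hg)).
  apply (@plus_opp_r F). }
exact (eq_of_plus_opp_eq_zero X x x' hz).
Qed.

Lemma eventually_gt_of_LimInf_ne_zero (u : nat -> R) :
  (forall n, 0 <= u n) -> LimInf_seq u <> Finite 0 ->
  exists c, 0 < c /\ exists N : nat, forall n, (N <= n)%nat -> c < u n.
Proof.
intros hu. unfold LimInf_seq. destruct (ex_LimInf_seq u) as [[l | |] hl]; simpl.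
- intros hne. assert (hl0 : 0 < l).
  { destruct (Rtotal_order l 0) as [hneg | [-> | hpos]]; [| easy | exact hpos].
    assert (heps : 0 < - l) by lra.
    destruct (hl (mkposreal _ heps)) as [hfreq _].
    destruct (hfreq 0%nat) as (n & _ & hn). simpl in hn.
    specialize (hu n). lra. }
  assert (heps : 0 < l / 2) by lra.
  destruct (hl (mkposreal _ heps)) as [_ [N hN]].
  exists (l / 2). split; [exact heps |].
  exists N. intros n hn. specialize (hN n hn). simpl in hN. lra.
- intros _. exists 1. split; [lra |]. exact (hl 1).
- destruct (hl 0 0%nat) as (n & _ & hn). specialize (hu n). lra.
Qed.

(** * Orbits of power bounded operators *)

Lemma op_pow_scal (F : AbsRing) (X : NormedModule F) (T : X -> X)
    (hT : is_linear T) (n : nat) (a : F) (x : X) :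
  op_pow T n (scal a x) = scal a (op_pow T n x).
Proof.
induction n as [| n IH]; [reflexivity |].
change (T (op_pow T n (scal a x)) = scal a (T (op_pow T n x))).
rewrite IH. apply (linear_scal T hT).
Qed.

Lemma power_bounded_unit_ball (F : AbsRing) (X : NormedModule F) (T : X -> X) :
  power_bounded T ->
  exists M : R, forall (n : nat) (x : X), norm x <= 1 -> norm (op_pow T n x) <= M.
Proof.
unfold power_bounded. intros hpb.
set (u := fun n => op_norm (op_pow T n)) in hpb.
assert (hle : forall n x, norm x <= 1 ->
                Rbar_le (norm (op_pow T n x)) (Sup_seq u)).
{ intros n x hx. apply (Sup_seq_minor_le u _ n).
  apply (Lub_Rbar_correct
           (fun r => exists x : X, norm x <= 1 /\ r = norm (op_pow T n x))).
  now exists x. }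
destruct (Sup_seq u) as [M | |]; [| easy |].
- now exists M.
- destruct (hle 0%nat zero). rewrite norm_zero. lra.
Qed.

Lemma power_bounded_orbit (F : AbsRing) (hF : fully_valued_field F)
    (X : NormedModule F) (T : X -> X) (hT : is_linear T)
    (hpb : power_bounded T) (y : X) :
  exists B : R, 0 < B /\ forall n : nat, norm (op_pow T n y) <= B.
Proof.
destruct (power_bounded_unit_ball F X T hpb) as [M hM].
destruct hF as (_ & hinv & hreal & _).
assert (hy := norm_ge_0 y).
(* the scalar [a] brings [y] into the unit ball *)
destruct (hreal (/ (1 + norm y))) as [a ha]; [apply Rinv_0_lt_compat; lra |].
assert (hay : norm (scal a y) <= 1).
{ apply (Rle_trans _ _ _ (norm_scal a y)). rewrite ha.
  apply (Rmult_le_reg_l (1 + norm y)); [lra |].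
  rewrite <- Rmult_assoc, Rinv_r; lra. }
assert (ha0 : a <> zero).
{ intros ->. rewrite abs_zero in ha.
  assert (h := Rinv_0_lt_compat (1 + norm y)). lra. }
destruct (hinv a ha0) as [b hb].
assert (hb0 := abs_ge_0 b).
assert (hM0 : 0 <= M).
{ apply (Rle_trans _ _ _ (norm_ge_0 _) (hM 0%nat _ hay)). }
exists (abs b * M + 1). split; [nra |].
intros n. rewrite <- (scal_one y), <- hb, <- scal_assoc, (op_pow_scal F X T hT).
apply (Rle_trans _ _ _ (norm_scal _ _)).
specialize (hM n _ hay). nra.
Qed.

(** * The functional along a supercyclic orbit *)

Lemma finite_dimensional_of_injective_functional (F : AbsRing)
    (hF : fully_valued_field F) (X : NormedModule F)
    (f : X -> AbsRing_NormedModule F) (hf : dual_elt f) (x0 : X)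
    (hx0 : f x0 <> zero) (hker : forall x, f x = zero -> x = zero) :
  ~ infinite_dimensional X.
Proof.
destruct hF as (_ & hinv & _). destruct (hinv (f x0) hx0) as [b hb].
intros hdim. apply hdim. exists 0%nat, (fun _ => x0). intros x.
exists (fun _ => mult (f x) b). rewrite sum_O.
apply (eq_of_plus_opp_eq_zero X), hker. rewrite (linear_plus f hf), (linear_opp f _ hf), (linear_scal f hf).
change (plus (f x) (opp (mult (mult (f x) b) (f x0))) = (zero : F)).
rewrite <- mult_assoc, hb, mult_one_r. exact (plus_opp_r (f x : F)).
Qed.

(** The scalars [a k] are controlled through [f]: since [|f (v k)| > c], the
    products [a k * f (v k)] can only vanish in the limit if [a k] does. *)
Lemma norm_conv_zero_of_functional (F : AbsRing) (hF : fully_valued_field F)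
    (X : NormedModule F) (f : X -> AbsRing_NormedModule F) (hf : dual_elt f)
    (a : nat -> F) (v : nat -> X) (B c : R) (N : nat) :
  0 < B -> (forall k, norm (v k) <= B) ->
  0 < c -> (forall k, (N <= k)%nat -> c < norm (f (v k))) ->
  norm_conv (fun k => f (scal (a k) (v k))) zero ->
  norm_conv (fun k => scal (a k) (v k)) zero.
Proof.
intros hB hv hc hfv hlim. rewrite norm_conv_zero_iff in hlim.
apply norm_conv_zero_iff. intros eps heps.
destruct (hlim (c * (eps / B))) as [K hK].
{ apply Rmult_lt_0_compat; [exact hc | now apply Rdiv_lt_0_compat]. }
exists (Nat.max N K). intros k hk.
specialize (hK k ltac:(lia)). specialize (hfv k ltac:(lia)). specialize (hv k).
rewrite (linear_scal f hf) in hK.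
change (abs (mult (a k) (f (v k))) < c * (eps / B)) in hK.
rewrite (proj1 hF) in hK. change (c < abs (f (v k))) in hfv.
assert (ha := abs_ge_0 (a k)).
assert (hak : abs (a k) < eps / B).
{ apply (Rmult_lt_reg_l c); [exact hc | nra]. }
apply (Rle_lt_trans _ _ _ (norm_scal _ _)).
apply (Rle_lt_trans _ (abs (a k) * B)); [nra |].
replace eps with (eps / B * B) by (field; lra).
now apply Rmult_lt_compat_r.
Qed.

Lemma le_subseq_index (phi : nat -> nat) (hphi : subseq_index phi) (k : nat) :
  (k <= phi k)%nat.
Proof. induction k as [| k IH]; [lia |]. specialize (hphi k). lia. Qed.

Lemma LimInf_functional_orbit (F : AbsRing) (hF : fully_valued_field F)
    (X : NormedModule F) (hdim : infinite_dimensional X) (htype : type1 X)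
    (T : X -> X) (hT : is_linear T) (hpb : power_bounded T)
    (y : X) (hy : wl_supercyclic_vector T y)
    (f : X -> AbsRing_NormedModule F) (hf : dual_elt f)
    (hf0 : exists x : X, f x <> zero) :
  LimInf_seq (fun n => norm (f (op_pow T n y))) = Finite 0.
Proof.
apply NNPP. intros hne.
destruct (eventually_gt_of_LimInf_ne_zero _ (fun n => norm_ge_0 _) hne)
  as (c & hc & N & hN).
destruct (power_bounded_orbit F hF X T hT hpb y) as (B & hB & hBy).
destruct hf0 as [x0 hx0].
apply (finite_dimensional_of_injective_functional F hF X f hf x0 hx0);
  [| exact hdim].
intros x hx.
destruct (proj2 hy x) as (a & phi & _ & hphi & hweak).
apply (weak_conv_unique F hF X htype _ x zero hweak).
apply htype.
apply (norm_conv_zero_of_functional F hF X f hf a _ B c N);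
  [exact hB | intros k; apply hBy | exact hc | |].
- intros k hk. apply hN.
  apply (Nat.le_trans _ k); [exact hk | now apply le_subseq_index].
- rewrite <- hx. exact (hweak f hf).
Qed.

Theorem theorem6p2 (F : AbsRing) (hF : F = R_AbsRing \/ F = C_AbsRing)
    (X : NormedModule F)
    (hdim : infinite_dimensional X) (htype : type1 X)
    (T : X -> X) (hT : is_linear T)
    (hpb : power_bounded T) (hsc : wl_supercyclic T) :
  weakly_stable T \/
  (forall y : X, wl_supercyclic_vector T y ->
     ~ weak_conv (fun n => op_pow T n y) zero ->
     forall f : X -> AbsRing_NormedModule F, dual_elt f ->
       (exists x : X, f x <> zero) ->
       ~ norm_conv (fun n => f (op_pow T n y)) zero ->
       LimInf_seq (fun n => norm (f (op_pow T n y))) = Finite 0 \/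
       exists phi : nat -> nat, subseq_index phi /\
         Rbar_lt (LimSup_seq (fun k => norm (f (op_pow T (phi k) y))))
                 (Rbar_mult (op_norm f)
                    (LimSup_seq (fun k => norm (op_pow T (phi k) y))))).
Proof.
assert (hval : fully_valued_field F).
{ destruct hF as [-> | ->]; [exact fully_valued_R | exact fully_valued_C]. }
right. intros y hy _ f hf hf0 _. left.
exact (LimInf_functional_orbit F hval X hdim htype T hT hpb y hy f hf hf0).
Qed.
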